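(* Let $\lambda>0$, let $\mathcal C(\theta)=(x_1(\theta),x_2(\theta),x_3(\theta))$ be a curve in the Heisenberg group $H_1$, and let $Y(s,\theta)$ be the constant $p$-mean curvature surface ($H=2\lambda$) obtained by deforming the Pansu sphere along $\mathcal C$, with associated functions $A,B,D,V,\zeta,G$ of $\theta$ (all defined in the context). If $V=0$, then $\alpha=0$. If $V\neq0$, consider the new coordinates $$\tilde s=s+\Gamma(\theta),\qquad \tilde\theta=\Psi(\theta),$$ where $$\Gamma(\theta)=\frac{\theta}{2\lambda}-\int D(\theta)\,d\theta,\qquad \Psi(\theta)=2\lambda\int\|V(\theta)\|\,d\theta .$$ Then the coordinate system $(\tilde s,\tilde\theta)$ is normal, and in terms of these normal coordinates the invariants of $Y$ are $$\zeta_1(\tilde\theta)=\zeta(\theta)-2\lambda\Gamma(\theta),\qquad \zeta_2(\tilde\theta)=G(\theta),\qquad\text{where }\theta=\Psi^{-1}(\tilde\theta).$$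
   Context: Heisenberg group: $H_1=\mathbb{R}^3$ with product $(x_1,y_1,z_1)\circ(x_2,y_2,z_2)=(x_1+x_2,y_1+y_2,z_1+z_2+y_1x_2-x_1y_2)$. Left-invariant fields: $\mathring e_1=\partial_x+y\partial_z$, $\mathring e_2=\partial_y-x\partial_z$, $T=\partial_z$. The contact bundle $\xi$ is spanned by $\mathring e_1,\mathring e_2$, the kernel of $\Theta=dz+x\,dy-y\,dx$; $J\mathring e_1=\mathring e_2$, $J\mathring e_2=-\mathring e_1$; $\nabla$ is the connection for which $\mathring e_1,\mathring e_2,T$ are parallel; the adapted metric makes them orthonormal. Surfaces: a point $p$ of a surface $\Sigma$ is regular if $T_p\Sigma\ne\xi_p$. On the regular part $e_1$ is a unit field spanning $T\Sigma\cap\xi$, $e_2=Je_1$, $H$ is defined by $\nabla_{e_1}e_2=-He_1$, and $\alpha$ is the function with $\alpha e_2+T$ tangent to $\Sigma$. Set $\hat e_2=(\alpha e_2+T)/\sqrt{1+\alpha^2}$. Coordinates $(s,\theta)$ on the regular part are compatible if $e_1=\partial_s$; then $\hat e_2=a\,\partial_s+b\,\partial_\theta$ defines $a,b$. Normal coordinates and invariants ($H=2\lambda$, $\alpha$ not vanishing): compatible coordinates $(s,\theta)$ are normal if $$\alpha=\lambda\frac{\sin(2\lambda s+\zeta_1(\theta))}{\zeta_2(\theta)-\cos(2\lambda s+\zeta_1(\theta))},\quad a=\frac{-\lambda}{\sqrt{1+\alpha^2}},\quad b=\frac{2\lambda^2}{\big|\zeta_2(\theta)-\cos(2\lambda s+\zeta_1(\theta))\big|\sqrt{1+\alpha^2}};$$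 $\zeta_1,\zeta_2$ are then the invariants of the surface. The deformed surface: let $x(s)=\frac1{2\lambda}\sin(2\lambda s)$, $y(s)=-\frac1{2\lambda}\cos(2\lambda s)+\frac1{2\lambda}$, $t(s)=\frac1{4\lambda^2}\sin(2\lambda s)-\frac1{2\lambda}s+\frac{\pi}{4\lambda^2}$ (the rotations of the curve $(x(s),y(s),t(s))$, $0\le s\le\pi/\lambda$, about the third axis sweep out the Pansu sphere), and $$Y(s,\theta)=\big(x_1(\theta)+P,\ x_2(\theta)+Q,\ x_3(\theta)+t(s)+x_2(\theta)P-x_1(\theta)Q\big),$$ with $P=x(s)\cos\theta-y(s)\sin\theta$, $Q=x(s)\sin\theta+y(s)\cos\theta$. $Y$ is always considered on a region where it is an immersion, $e_1=Y_s$ (so $(s,\theta)$ is compatible), and $\alpha,a,b$ are considered on its regular part. Put $$A=x_2'\cos\theta-x_1'\sin\theta,\quad B=x_2'\sin\theta+x_1'\cos\theta,\quad D=\lambda\,\Theta(\mathcal C')+\tfrac1{2\lambda}-B,\quad V=\big(A,\tfrac1{2\lambda}-B\big),$$ where $\Theta(\mathcal C')=x_3'+x_1x_2'-x_2x_1'$ and all are functions of $\theta$. For nonzero $V(\theta)$, $\|V\|=\sqrt{A^2+(\frac1{2\lambda}-B)^2}$, $G=D/\|V\|$, and $\zeta(\theta)$ is a function with $V/\|V\|=(\sin\zeta(\theta),\cos\zeta(\theta))$. The symbol $\int$ denotes an antiderivative.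
   Formalization: As written the claim fails where b<0 (e.g. λ=1, C=(0,0,−2θ): b=−1/2, formula gives +1/2); the formal theorem states it verbatim on the regular points with b>0, and on those with b<0 uses θ̃=−Ψ(θ) instead, with the same ζ1, ζ2 as functions of θ. *)

(* Defs.v *)
(* Stdlib reals with Coquelicot. *)
From Stdlib Require Import Reals.
From Coquelicot Require Import Coquelicot.
Open Scope R_scope.

(* Points of H_1 and tangent vectors (in the coordinate basis d/dx, d/dy, d/dz)
   are both triples of reals. *)
Definition R3 : Type := (R * R * R)%type.
Definition c1 (p : R3) : R := fst (fst p).
Definition c2 (p : R3) : R := snd (fst p).
Definition c3 (p : R3) : R := snd p.

Definition vadd (v w : R3) : R3 := (c1 v + c1 w, c2 v + c2 w, c3 v + c3 w).
Definition vscale (k : R) (v : R3) : R3 := (k * c1 v, k * c2 v, k * c3 v).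

(** ** The Heisenberg group *)

Definition Hmul (p q : R3) : R3 :=
  (c1 p + c1 q, c2 p + c2 q, c3 p + c3 q + c2 p * c1 q - c1 p * c2 q).

Definition E1 (p : R3) : R3 := (1, 0, c2 p).
Definition E2 (p : R3) : R3 := (0, 1, - c1 p).
Definition ET (p : R3) : R3 := (0, 0, 1).

Definition Theta (p v : R3) : R := c3 v + c1 p * c2 v - c2 p * c1 v.
Definition contact (p v : R3) : Prop := Theta p v = 0.

(* Components of v in the frame (E1, E2, ET) at p:
   v = c1 v E1 + c2 v E2 + Theta p v ET. *)
Definition frame (p v : R3) : R3 := (c1 v, c2 v, Theta p v).

Definition metric (p v w : R3) : R :=
  c1 (frame p v) * c1 (frame p w) + c2 (frame p v) * c2 (frame p w)
  + c3 (frame p v) * c3 (frame p w).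

(* J E1 = E2 and J E2 = - E1; only applied to contact vectors. *)
Definition J (p v : R3) : R3 :=
  vadd (vscale (c1 v) (E2 p)) (vscale (- c2 v) (E1 p)).

(** ** Parametrized surfaces *)

(* Parametrized surfaces in H_1 and vector fields along them share this type;
   they are total, and only meaningful on an open set W of parameters. *)
Definition surface : Type := R -> R -> R3.

Definition d_s (F : surface) : surface := fun s t =>
  (Derive (fun u => c1 (F u t)) s, Derive (fun u => c2 (F u t)) s,
   Derive (fun u => c3 (F u t)) s).
Definition d_t (F : surface) : surface := fun s t =>
  (Derive (fun u => c1 (F s u)) t, Derive (fun u => c2 (F s u)) t,
   Derive (fun u => c3 (F s u)) t).

Definition open2 (W : R -> R -> Prop) : Prop :=
  forall s t, W s t -> locally_2d W s t.

Definition C1_on (W : R -> R -> Prop) (f : R -> R -> R) : Prop :=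
  forall s t, W s t ->
    ex_derive (fun u => f u t) s /\ ex_derive (fun u => f s u) t /\
    continuity_2d_pt (fun u v => Derive (fun w => f w v) u) s t /\
    continuity_2d_pt (fun u v => Derive (fun w => f u w) v) s t.

Definition immersion_on (W : R -> R -> Prop) (F : surface) : Prop :=
  open2 W /\
  C1_on W (fun s t => c1 (F s t)) /\
  C1_on W (fun s t => c2 (F s t)) /\
  C1_on W (fun s t => c3 (F s t)) /\
  forall s t, W s t -> forall c d : R,
    vadd (vscale c (d_s F s t)) (vscale d (d_t F s t)) = (0, 0, 0) ->
    c = 0 /\ d = 0.

Definition tangent (F : surface) (s t : R) (v : R3) : Prop :=
  exists c d : R, v = vadd (vscale c (d_s F s t)) (vscale d (d_t F s t)).

Definition regular (F : surface) (s t : R) : Prop :=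
  ~ (forall v : R3, tangent F s t v <-> contact (F s t) v).

Definition is_e1 (F : surface) (s t : R) (e : R3) : Prop :=
  tangent F s t e /\ contact (F s t) e /\ metric (F s t) e e = 1.

Definition e2 (F e1 : surface) : surface := fun s t => J (F s t) (e1 s t).

(* Z is the derivative nabla_w X, at the point with parameters (s,t), of the
   field X along F in the direction w = u F_s + v F_t. As E1, E2, ET are
   parallel, nabla differentiates the frame components. *)
Definition is_nabla (F X : surface) (s t u v : R) (Z : R3) : Prop :=
  let comp r := frame (F (s + r * u) (t + r * v)) (X (s + r * u) (t + r * v)) in
  is_derive (fun r => c1 (comp r)) 0 (c1 (frame (F s t) Z)) /\
  is_derive (fun r => c2 (comp r)) 0 (c2 (frame (F s t) Z)) /\
  is_derive (fun r => c3 (comp r)) 0 (c3 (frame (F s t) Z)).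

Definition is_H (F e1 : surface) (s t h : R) : Prop :=
  exists u v : R,
    e1 s t = vadd (vscale u (d_s F s t)) (vscale v (d_t F s t)) /\
    is_nabla F (e2 F e1) s t u v (vscale (- h) (e1 s t)).

(* The value al is unique at regular points of an immersion; at singular points
   no value qualifies. *)
Definition is_alpha (F e1 : surface) (s t al : R) : Prop :=
  tangent F s t (vadd (vscale al (e2 F e1 s t)) (ET (F s t))).

Definition e2hat (F e1 : surface) (s t al : R) : R3 :=
  vscale (/ sqrt (1 + al ^ 2))
         (vadd (vscale al (e2 F e1 s t)) (ET (F s t))).

Definition compatible (W : R -> R -> Prop) (F e1 : surface) : Prop :=
  forall s t, W s t -> e1 s t = d_s F s t.

Definition is_ab (F e1 : surface) (s t al a b : R) : Prop :=
  e2hat F e1 s t al = vadd (vscale a (d_s F s t)) (vscale b (d_t F s t)).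

(* The parameters of F on W are normal coordinates, with invariants zeta1 and
   zeta2, of a surface with H = 2 lambda whose unit characteristic field is e1.
   "alpha not vanishing" means that alpha is not identically zero on any
   nonempty open set: in normal coordinates alpha has isolated zeros on every
   e1-curve, namely those of the sine. *)
Record normal (lambda : R) (W : R -> R -> Prop) (F e1 : surface)
    (zeta1 zeta2 : R -> R) : Prop := {
  normal_immersion : immersion_on W F;
  normal_regular : forall s t, W s t -> regular F s t;
  normal_e1 : forall s t, W s t -> is_e1 F s t (e1 s t);
  normal_compatible : compatible W F e1;
  normal_H : forall s t, W s t -> is_H F e1 s t (2 * lambda);
  normal_alpha_nonvanishing : forall s t (eps : posreal), W s t ->
    exists s' t', Rabs (s' - s) < eps /\ Rabs (t' - t) < eps /\ W s' t' /\
      ~ is_alpha F e1 s' t' 0;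
  normal_formulas : forall s t, W s t ->
    let q := zeta2 t - cos (2 * lambda * s + zeta1 t) in
    let al := lambda * (sin (2 * lambda * s + zeta1 t) / q) in
    q <> 0 /\
    is_alpha F e1 s t al /\
    is_ab F e1 s t al (- lambda / sqrt (1 + al ^ 2))
      (2 * lambda ^ 2 / (Rabs q * sqrt (1 + al ^ 2)))
}.

(* The functions s~ = s + Gamma th, th~ = Phi th of (s,th) in U are normal
   coordinates of F, with invariants zeta1(th~) = z1 th and zeta2(th~) = z2 th,
   th = Phi^-1(th~): the surface reparametrized by (s~,th~), on the image of U,
   is in normal coordinates. I is the interval over which U lies. *)
Definition normal_change (lambda : R) (I : R -> Prop) (U : R -> R -> Prop)
    (F e1 : surface) (Gamma Phi z1 z2 : R -> R) : Prop :=
  exists Phi_inv : R -> R,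
    (forall th, I th -> Phi_inv (Phi th) = th) /\
    let reparam (X : surface) : surface :=
      fun s t => X (s - Gamma (Phi_inv t)) (Phi_inv t) in
    normal lambda
      (fun s' t' => exists s th, U s th /\ s' = s + Gamma th /\ t' = Phi th)
      (reparam F) (reparam e1)
      (fun t => z1 (Phi_inv t)) (fun t => z2 (Phi_inv t)).

(* The regular points of U at which b has the sign of eps, i.e. the
   frame (e1, e2hat) has orientation eps in the compatible coordinates. *)
Definition regular_part (eps : R) (U : R -> R -> Prop) (F e1 : surface)
    (s t : R) : Prop :=
  U s t /\ regular F s t /\
  exists al a b, is_alpha F e1 s t al /\ is_ab F e1 s t al a b /\ 0 < eps * b.

(** ** Deformation of the Pansu sphere along a curve *)

Definition Interval (l r : Rbar) (th : R) : Prop := Rbar_lt l th /\ Rbar_lt th r.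

Definition C1_curve_on (I : R -> Prop) (x : R -> R) : Prop :=
  forall th, I th -> ex_derive x th /\ continuous (Derive x) th.

Definition pansu (lambda s : R) : R3 :=
  (1 / (2 * lambda) * sin (2 * lambda * s),
   - (1 / (2 * lambda)) * cos (2 * lambda * s) + 1 / (2 * lambda),
   1 / (4 * lambda ^ 2) * sin (2 * lambda * s) - 1 / (2 * lambda) * s
   + PI / (4 * lambda ^ 2)).

Definition rot (th : R) (p : R3) : R3 :=
  (c1 p * cos th - c2 p * sin th, c1 p * sin th + c2 p * cos th, c3 p).

Definition deformed (lambda : R) (x1 x2 x3 : R -> R) : surface := fun s th =>
  Hmul (x1 th, x2 th, x3 th) (rot th (pansu lambda s)).

Definition funA (x1 x2 : R -> R) (th : R) : R :=
  Derive x2 th * cos th - Derive x1 th * sin th.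
Definition funB (x1 x2 : R -> R) (th : R) : R :=
  Derive x2 th * sin th + Derive x1 th * cos th.
Definition funD (lambda : R) (x1 x2 x3 : R -> R) (th : R) : R :=
  lambda * Theta (x1 th, x2 th, x3 th) (Derive x1 th, Derive x2 th, Derive x3 th)
  + 1 / (2 * lambda) - funB x1 x2 th.
Definition funV (lambda : R) (x1 x2 : R -> R) (th : R) : R * R :=
  (funA x1 x2 th, 1 / (2 * lambda) - funB x1 x2 th).
Definition norm2 (v : R * R) : R := sqrt (fst v ^ 2 + snd v ^ 2).
Definition funG (lambda : R) (x1 x2 x3 : R -> R) (th : R) : R :=
  funD lambda x1 x2 x3 th / norm2 (funV lambda x1 x2 th).

(* Main.v *)
Require Import Defs.
From Stdlib Require Import Reals Lra ClassicalEpsilon.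
From Coquelicot Require Import Coquelicot.
(* Restores the projection [c1], which the imports above hide. *)
Import Defs.
Open Scope R_scope.

(** The proof is a computation in the moving frame (e1, J e1, T) along the
    surface. For a compatible parametrization [F] with [F_s = e1], write
    [F_t = u e1 + w J e1 + tau T] (predicate [adapted]). The second tangent
    direction is then visible: a point is regular iff [tau] is nonzero, and there
    [alpha = w / tau], [a = - u / (tau r)] and [b = 1 / (tau r)] with
    [r = sqrt (1 + alpha ^ 2)] ([is_alpha_adapted], [is_ab_adapted]).

    For the deformed Pansu sphere the vector [e1] has the angle
    [2 lambda s + theta] in the left-invariant frame, which gives [H = 2 lambda]
    at once ([is_nabla_deformed]). Resolving [Y_theta] along this rotating frame
    yields coefficients linear in the sine and cosine of [2 lambda s], whose
    coefficients are the components of [V] ([adapted_deformed]). If [V = 0], then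
    [w = 0] and alpha vanishes. Otherwise, with [N] the norm of [V] and
    [psi = 2 lambda s + zeta],
    [u = 1 / (2 lambda) - N cos psi], [w = N sin psi] and
    [tau = N / lambda (G - cos psi)] ([adapted_deformed_polar]), so that alpha has
    the normal form with phase [psi] and [zeta2 = G].

    The change [s' = s + Gamma], [t' = Psi] does not affect alpha, replaces
    [u] by [(u - Gamma') / Psi'] and [tau] by [tau / Psi'], and shifts the phase
    by [- 2 lambda Gamma] ([adapted_shear]). Normality of [a] asks for
    [u - Gamma' = lambda tau], that is [Gamma' = 1 / (2 lambda) - D], because
    [N G = D]; normality of [b] asks for [Psi' = 2 lambda N], up to the
    sign of [G - cos psi]. This sign is the orientation of the frame, and is why
    the two parts of the regular set are reparametrized by [Psi] and by [- Psi]
    ([normal_change_deformed], where [eps] is the sign).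

    The analytic part is that the new parameters are again those of an immersion
    on an open set: [Psi] is strictly monotone, its inverse is of class C1
    ([monotone_inverse]), and C1 functions are stable under such changes of
    parameters ([C1_on_shear]). *)

(** * Inverse functions *)

Lemma is_derive_continuous (f : R -> R) (x df : R) :
  is_derive f x df -> continuous f x.
Proof.
  intros H. apply (ex_derive_continuous (V := R_NormedModule) f).
  now exists df.
Qed.

Lemma Interval_locally (l r : Rbar) (th : R) :
  Interval l r th -> locally th (Interval l r).
Proof.
  intros [Hl Hr].
  apply filter_and; [apply (open_Rbar_gt l th Hl) | apply (open_Rbar_lt r th Hr)].
Qed.

(** The difference quotient of [g] at [f x] with increment [h] is the inverse of
    the difference quotient of [f] at [x] with increment [g (f x + h) - x],
    and this increment tends to [0] without vanishing. *)
Lemma is_derive_inverse (f g : R -> R) (x df : R) :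
  is_derive f x df -> df <> 0 -> g (f x) = x -> continuous g (f x) ->
  locally (f x) (fun y => f (g y) = y) ->
  is_derive g (f x) (/ df).
Proof.
  intros Hf Hdf Hgx Hg Hinv.
  assert (Lf : is_lim (fun k => (f (x + k) - f x) / k) 0 df).
  { apply is_lim_spec. intros eps.
    apply is_derive_Reals in Hf.
    destruct (Hf eps (cond_pos eps)) as [d Hd].
    exists d. intros k Hk Hk0. apply Hd; [exact Hk0 |].
    unfold ball, AbsRing_ball, abs, minus, plus, opp in Hk; simpl in Hk.
    unfold AbsRing_ball, abs, minus, plus, opp in Hk; simpl in Hk.
    now rewrite Ropp_0, Rplus_0_r in Hk. }
  assert (Lg : is_lim (fun h => g (f x + h) - x) 0 0).
  { apply is_lim_spec. intros eps.
    assert (Hg' := proj1 (filterlim_locally g (g (f x))) Hg).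
    destruct (Hg' eps) as [d Hd]. exists d. intros h Hh _.
    assert (B := Hd (f x + h)).
    unfold ball in B, Hh; simpl in B, Hh.
    unfold AbsRing_ball, abs, minus, plus, opp in B, Hh; simpl in B, Hh.
    rewrite Hgx in B. unfold Rminus. rewrite Ropp_0, Rplus_0_r.
    apply B. now replace (f x + h + - f x) with (h + - 0) by ring. }
  destruct Hinv as [d0 Hinv].
  assert (Hne : forall h, Rabs h < d0 -> f (g (f x + h)) = f x + h).
  { intros h Hh. apply Hinv. unfold ball; simpl.
    unfold AbsRing_ball, abs, minus, plus, opp; simpl.
    now replace (f x + h + - f x) with h by ring. }
  assert (Hin : forall h, ball 0 d0 h -> Rabs h < d0).
  { intros h Hh. unfold ball in Hh; simpl in Hh.
    unfold AbsRing_ball, abs, minus, plus, opp in Hh; simpl in Hh.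
    now rewrite Ropp_0, Rplus_0_r in Hh. }
  assert (L : is_lim (fun h => / ((f (x + (g (f x + h) - x)) - f x) / (g (f x + h) - x)))
                0 (/ df)).
  { apply (is_lim_comp (fun k => / ((f (x + k) - f x) / k)) _ 0 (/ df) 0).
    - apply (is_lim_inv _ 0 df); [exact Lf |].
      intros E; injection E; exact Hdf.
    - exact Lg.
    - exists d0. intros h Hh Hh0 E. injection E; intros E'.
      specialize (Hne h (Hin h Hh)).
      replace (g (f x + h)) with x in Hne by lra. lra. }
  apply is_derive_Reals. intros eps Heps.
  apply is_lim_spec in L. destruct (L (mkposreal eps Heps)) as [d1 Hd1].
  assert (Hm : 0 < Rmin d0 d1) by (apply Rmin_pos; apply cond_pos).
  exists (mkposreal _ Hm). simpl. intros h Hh0 Hh.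
  assert (Hh' : Rabs h < d0) by (eapply Rlt_le_trans; [exact Hh | apply Rmin_l]).
  assert (Hh1 : Rabs h < d1) by (eapply Rlt_le_trans; [exact Hh | apply Rmin_r]).
  specialize (Hne h Hh').
  assert (B : ball 0 d1 h).
  { unfold ball; simpl. unfold AbsRing_ball, abs, minus, plus, opp; simpl.
    now rewrite Ropp_0, Rplus_0_r. }
  specialize (Hd1 h B Hh0). simpl in Hd1.
  replace (x + (g (f x + h) - x)) with (g (f x + h)) in Hd1 by ring.
  rewrite Hne in Hd1. rewrite Hgx.
  assert (Hk : g (f x + h) - x <> 0).
  { intros E. replace (g (f x + h)) with x in Hne by lra. lra. }
  now replace ((g (f x + h) - x) / h) with
    (/ ((f x + h - f x) / (g (f x + h) - x))) by (field; lra).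
Qed.

(** The inverse is chosen by description; the intermediate value theorem shows
    that the image is a neighbourhood of each of its points and that the inverse
    is continuous there. *)
Lemma increasing_inverse (l r : Rbar) (f df : R -> R) :
  (forall x, Interval l r x -> is_derive f x (df x)) ->
  (forall x, Interval l r x -> 0 < df x) ->
  exists g : R -> R, forall x, Interval l r x ->
    g (f x) = x /\ locally (f x) (fun y => Interval l r (g y) /\ f (g y) = y) /\
    is_derive g (f x) (/ df x).
Proof.
  intros Hf Hpos.
  assert (mono : forall x y, Interval l r x -> Interval l r y -> x < y -> f x < f y).
  { intros x y [Hx _] [_ Hy] Hxy.
    apply (incr_function f l r df); auto.
    - intros z H1 H2; apply Hf; split; assumption.
    - intros z H1 H2; apply Rlt_gt, Hpos; split; assumption. }
  assert (inj : forall x y, Interval l r x -> Interval l r y -> f x = f y -> x = y).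
  { intros x y Hx Hy E. destruct (Rtotal_order x y) as [H | [H | H]]; auto.
    - specialize (mono x y Hx Hy H); lra.
    - specialize (mono y x Hy Hx H); lra. }
  set (g := fun y => epsilon (inhabits 0) (fun x => Interval l r x /\ f x = y)).
  assert (gK : forall x y, Interval l r x -> f x = y -> g y = x).
  { intros x y Hx E.
    assert (S := epsilon_spec (inhabits 0) (fun x => Interval l r x /\ f x = y)
      (ex_intro _ x (conj Hx E))).
    destruct S as [S1 S2]. apply inj; auto. now rewrite E. }
  exists g. intros x Hx.
  assert (near : forall eps : posreal, locally (f x) (fun y =>
      exists z, Interval l r z /\ f z = y /\ Rabs (z - x) < eps)).
  { intros eps. destruct (Interval_locally l r x Hx) as [d Hd].
    assert (Hm : 0 < Rmin d eps / 2)
      by (assert (0 < Rmin d eps) by (apply Rmin_pos; apply cond_pos); lra).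
    set (m := Rmin d eps / 2) in *.
    assert (md : m < d) by (assert (B := Rmin_l d eps); unfold m in *; lra).
    assert (me : m < eps) by (assert (B := Rmin_r d eps); unfold m in *; lra).
    assert (Hin : forall z, x - m <= z <= x + m -> Interval l r z).
    { intros z Hz. apply Hd. unfold ball; simpl.
      unfold AbsRing_ball, abs, minus, plus, opp; simpl.
      apply Rabs_def1; lra. }
    assert (Hc : forall z, x - m <= z <= x + m -> continuity_pt f z).
    { intros z Hz. apply continuity_pt_filterlim.
      apply (is_derive_continuous _ _ _ (Hf z (Hin z Hz))). }
    assert (H1 : f (x - m) < f x) by (apply mono; [apply Hin; lra | exact Hx | lra]).
    assert (H2 : f x < f (x + m)) by (apply mono; [exact Hx | apply Hin; lra | lra]).
    assert (He : 0 < Rmin (f x - f (x - m)) (f (x + m) - f x)) by (apply Rmin_pos; lra).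
    exists (mkposreal _ He). intros y Hy.
    unfold ball in Hy; simpl in Hy.
    unfold AbsRing_ball, abs, minus, plus, opp in Hy; simpl in Hy.
    apply Rabs_def2 in Hy.
    assert (B1 := Rmin_l (f x - f (x - m)) (f (x + m) - f x)).
    assert (B2 := Rmin_r (f x - f (x - m)) (f (x + m) - f x)).
    destruct (IVT_Rbar_incr f (x - m) (x + m) (f (x - m)) (f (x + m)) y)
      as (z & Z1 & Z2 & Z3).
    - apply is_lim_continuity, Hc; lra.
    - apply is_lim_continuity, Hc; lra.
    - simpl. intros z Z1 Z2. apply Hc; lra.
    - simpl; lra.
    - simpl; lra.
    - simpl in Z1, Z2. exists z. repeat split; auto; try (apply Hin; lra).
      apply Rabs_def1; lra. }
  assert (Hloc : locally (f x) (fun y => Interval l r (g y) /\ f (g y) = y)).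
  { generalize (near (mkposreal 1 Rlt_0_1)). apply filter_imp. intros y (z & Z1 & Z2 & _).
    rewrite (gK z y Z1 Z2). auto. }
  split; [now apply gK |]. split; [exact Hloc |].
  apply is_derive_inverse; auto.
  - specialize (Hpos x Hx); lra.
  - apply filterlim_locally. intros eps.
    specialize (near eps). revert near. apply filter_imp.
    intros y (z & Z1 & Z2 & Z3).
    rewrite (gK z y Z1 Z2), (gK x (f x) Hx eq_refl). exact Z3.
  - revert Hloc. apply filter_imp. tauto.
Qed.

(** The two orientations of the new coordinate are treated together, with the
    sign of the derivative as a parameter [eps], which is [1] or [-1]. *)
Lemma monotone_inverse (eps : R) (l r : Rbar) (f df : R -> R) :
  eps * eps = 1 ->
  (forall x, Interval l r x -> is_derive f x (df x)) ->
  (forall x, Interval l r x -> 0 < eps * df x) ->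
  exists g : R -> R, forall x, Interval l r x ->
    g (f x) = x /\ locally (f x) (fun y => Interval l r (g y) /\ f (g y) = y) /\
    is_derive g (f x) (/ df x).
Proof.
  intros He Hf Hpos.
  destruct (increasing_inverse l r (fun x => eps * f x) (fun x => eps * df x))
    as [g Hg]; auto.
  { intros x Hx. apply is_derive_scal, Hf, Hx. }
  exists (fun y => g (eps * y)). intros x Hx.
  destruct (Hg x Hx) as (G1 & G2 & G3).
  assert (C : continuous (fun y => eps * y) (f x)).
  { apply (ex_derive_continuous (fun y : R => eps * y)). auto_derive; auto. }
  split; [exact G1 |]. split.
  - specialize (C _ G2). revert C. unfold filtermap. apply filter_imp.
    intros y [Y1 Y2]. split; [exact Y1 |].
    apply (Rmult_eq_compat_l eps) in Y2. rewrite <- !Rmult_assoc, He in Y2. lra.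
  - specialize (Hpos x Hx).
    assert (eps <> 0) by (intros E; rewrite E in Hpos; lra).
    assert (df x <> 0) by (intros E; rewrite E in Hpos; lra).
    replace (/ df x) with (eps * / (eps * df x)) by (field; auto).
    apply (is_derive_comp g (fun y => eps * y)); [exact G3 |].
    auto_derive; auto; ring.
Qed.

(** * Changes of coordinates that preserve the s-curves *)

(** The coordinate changes [s = s' - K t'], [t = g t'] are those under which the
    derivative along the first parameter keeps its value, so that compatible
    coordinates remain compatible. For the normal coordinates, [g] is the inverse
    of [Psi] or [- Psi] and [K] is the composite of [Gamma] with [g]. *)
Definition shear {T : Type} (K g : R -> R) (X : R -> R -> T) : R -> R -> T :=
  fun s t => X (s - K t) (g t).

Lemma filterlim_shear (K g : R -> R) (s t : R) :
  continuous K t -> continuous g t ->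
  filterlim (fun z : R * R => (fst z - K (snd z), g (snd z)))
    (locally (s, t)) (locally (s - K t, g t)).
Proof.
  intros HK Hg.
  refine (filterlim_filter_le_2 _ _ (filterlim_pair
    (fun z : R * R => fst z - K (snd z)) (fun z : R * R => g (snd z)) _ _)).
  - intros P [d Hd]. exists (ball (s - K t) d) (ball (g t) d).
    + apply locally_ball.
    + apply locally_ball.
    + intros x y Hx Hy. apply Hd. split; assumption.
  - apply (continuous_minus (V := R_NormedModule)
      (fun z : R * R => fst z) (fun z : R * R => K (snd z))).
    + apply continuous_fst.
    + apply (continuous_comp snd K (s, t)); [apply continuous_snd | exact HK].
  - apply (continuous_comp snd g (s, t)); [apply continuous_snd | exact Hg].
Qed.

Lemma locally_2d_shear (P : R -> R -> Prop) (K g : R -> R) (s t : R) :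
  locally_2d P (s - K t) (g t) -> continuous K t -> continuous g t ->
  locally_2d (shear K g P) s t.
Proof.
  intros HP HK Hg. apply locally_2d_locally in HP. apply locally_2d_locally.
  apply (filterlim_shear K g s t HK Hg _ HP).
Qed.

Lemma continuity_2d_pt_shear (h : R -> R -> R) (K g : R -> R) (s t : R) :
  continuity_2d_pt h (s - K t) (g t) -> continuous K t -> continuous g t ->
  continuity_2d_pt (shear K g h) s t.
Proof.
  intros Hh HK Hg.
  apply continuity_2d_pt_filterlim in Hh. apply continuity_2d_pt_filterlim.
  apply (filterlim_comp _ _ _ _ _ _ _ _ (filterlim_shear K g s t HK Hg) Hh).
Qed.

(** Continuous partial derivatives give the differentiability that the chain rule
    along a curve of parameters requires. *)
Lemma C1_on_filterdiff (U : R -> R -> Prop) (f : R -> R -> R) (x y : R) :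
  open2 U -> C1_on U f -> U x y ->
  filterdiff (fun u : R * R => f (fst u) (snd u)) (locally (x, y))
    (fun u : R * R => plus (scal (fst u) (Derive (fun u => f u y) x))
       (scal (snd u) (Derive (fun u => f x u) y))).
Proof.
  intros HU Hf Hxy. destruct (Hf _ _ Hxy) as (F1 & F2 & F3 & F4).
  apply (is_derive_filterdiff f x y (fun x y => Derive (fun u => f u y) x)).
  - assert (L := HU _ _ Hxy). apply locally_2d_locally in L. revert L.
    apply filter_imp. intros u Hu. apply Derive_correct. apply (Hf _ _ Hu).
  - apply Derive_correct, F2.
  - apply continuity_2d_pt_filterlim in F3. exact F3.
Qed.

Lemma C1_on_continuity_2d (U : R -> R -> Prop) (f : R -> R -> R) (x y : R) :
  open2 U -> C1_on U f -> U x y -> continuity_2d_pt f x y.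
Proof.
  intros HU Hf Hxy. apply continuity_2d_pt_filterlim.
  apply (filterdiff_continuous (fun u : R * R => f (fst u) (snd u)) (x, y)).
  eexists. apply (C1_on_filterdiff U); assumption.
Qed.

Lemma is_derive_shear (U : R -> R -> Prop) (f : R -> R -> R) (K g : R -> R)
    (s t dK dg : R) :
  open2 U -> C1_on U f -> U (s - K t) (g t) ->
  is_derive K t dK -> is_derive g t dg ->
  is_derive (fun u => shear K g f s u) t
    (dg * Derive (fun u => f (s - K t) u) (g t)
     - dK * Derive (fun u => f u (g t)) (s - K t)).
Proof.
  intros HU Hf Hst HK Hg. unfold shear.
  assert (D := C1_on_filterdiff U f _ _ HU Hf Hst).
  assert (P : is_derive (fun u => s - K u) t (- dK)).
  { auto_derive; [now exists dK |].
    replace (Derive (fun x => K x) t) with dK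
      by (symmetry; now apply is_derive_unique).
    ring. }
  eapply filterdiff_ext_lin.
  { apply (filterdiff_comp'_2 (T := R_NormedModule) (U := R_NormedModule)
      (V := R_NormedModule) (W := R_NormedModule) (fun u => s - K u) g f t _ _
      (fun a b => plus (scal a (Derive (fun u => f u (g t)) (s - K t)))
         (scal b (Derive (fun u => f (s - K t) u) (g t)))) P Hg D). }
  intros y. simpl. unfold scal, plus; simpl. unfold mult; simpl. ring.
Qed.

(** For fixed [t] the change of coordinates is a translation in [s], so that the
    difference quotients agree. *)
Lemma Derive_shear_s (f : R -> R -> R) (K g : R -> R) (s t : R) :
  Derive (fun u => shear K g f u t) s = Derive (fun u => f u (g t)) (s - K t).
Proof.
  unfold shear, Derive. f_equal. apply Lim_ext. intros h.
  do 3 f_equal. ring.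
Qed.

Lemma C1_on_shear (U W : R -> R -> Prop) (f : R -> R -> R) (K g dK dg : R -> R) :
  open2 U -> open2 W -> C1_on U f ->
  (forall s t, W s t -> U (s - K t) (g t)) ->
  (forall s t, W s t -> is_derive K t (dK t) /\ is_derive g t (dg t) /\
     continuous dK t /\ continuous dg t) ->
  C1_on W (shear K g f).
Proof.
  intros HU HW Hf HWU Hd s t Hst.
  destruct (Hd s t Hst) as (D1 & D2 & D3 & D4).
  assert (CK : continuous K t) by (apply (is_derive_continuous _ _ _ D1)).
  assert (Cg : continuous g t) by (apply (is_derive_continuous _ _ _ D2)).
  destruct (Hf _ _ (HWU s t Hst)) as (F1 & F2 & F3 & F4).
  split; [| split; [| split]].
  - unfold shear. apply (ex_derive_comp (fun u => f u (g t)) (fun u => u - K t)).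
    + exact F1.
    + auto_derive; auto.
  - eexists. eapply (is_derive_shear U); eauto.
  - apply continuity_2d_pt_ext with
      (f := shear K g (fun x y => Derive (fun w => f w y) x)).
    + intros x y. symmetry. apply Derive_shear_s.
    + apply continuity_2d_pt_shear; auto.
  - apply continuity_2d_pt_ext_loc with (f := fun x y =>
      dg y * shear K g (fun x y => Derive (fun w => f x w) y) x y
      - dK y * shear K g (fun x y => Derive (fun w => f w y) x) x y).
    + assert (L := HW _ _ Hst). revert L. apply locally_2d_impl, locally_2d_forall.
      intros x y Hxy. symmetry. apply is_derive_unique.
      destruct (Hd x y Hxy) as (E1 & E2 & _).
      apply (is_derive_shear U); auto.
    + apply continuity_2d_pt_minus; apply continuity_2d_pt_mult;
        try (apply continuity_2d_pt_shear; auto).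
      * apply (continuity_1d_2d_pt_comp dg); [now apply continuity_pt_filterlim |].
        apply continuity_2d_pt_id2.
      * apply (continuity_1d_2d_pt_comp dK); [now apply continuity_pt_filterlim |].
        apply continuity_2d_pt_id2.
Qed.
(** * Surfaces in the frame (e1, J e1, T) *)

Definition comb (p e : R3) (a b c : R) : R3 :=
  vadd (vscale a e) (vadd (vscale b (J p e)) (vscale c (ET p))).

Definition unit_contact (p e : R3) : Prop := contact p e /\ metric p e e = 1.

Lemma unit_contact_coords (p e : R3) :
  unit_contact p e ->
  c3 e = c2 p * c1 e - c1 p * c2 e /\ c1 e * c1 e + c2 e * c2 e = 1.
Proof.
  intros [Hc Hm]. unfold metric, frame in Hm. simpl in Hm.
  unfold contact in Hc. rewrite Hc in Hm. unfold Theta in Hc.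
  cbn in Hm. split; [lra | unfold c1, c2 in *; simpl in *; lra].
Qed.

Ltac triple :=
  cbv [comb vadd vscale J E1 E2 ET Theta c1 c2 c3 fst snd] in *.

(** As [e] and [J p e] form a rotation of the coordinate plane in the first two
    components, and both are killed by [Theta p], the coefficients of a
    combination are recovered by scalar products and [Theta]. *)
Lemma comb_coords (p e : R3) (a b c : R) :
  unit_contact p e ->
  let v := comb p e a b c in
  c1 v * c1 e + c2 v * c2 e = a /\ c2 v * c1 e - c1 v * c2 e = b /\ Theta p v = c.
Proof.
  intros He v. destruct (unit_contact_coords p e He) as [H3 H1].
  destruct p as [[p1 p2] p3], e as [[C S] z]. unfold v. triple. subst z.
  assert (H : C * C = 1 - S * S) by lra.
  repeat split; ring [H].
Qed.

Lemma comb_inj (p e : R3) (a b c a' b' c' : R) :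
  unit_contact p e -> comb p e a b c = comb p e a' b' c' ->
  a = a' /\ b = b' /\ c = c'.
Proof.
  intros He E.
  destruct (comb_coords p e a b c He) as (Ha & Hb & Hc).
  destruct (comb_coords p e a' b' c' He) as (Ha' & Hb' & Hc').
  rewrite E in Ha, Hb, Hc. repeat split; congruence.
Qed.

Lemma comb_decomp (p e v : R3) :
  unit_contact p e ->
  v = comb p e (c1 v * c1 e + c2 v * c2 e) (c2 v * c1 e - c1 v * c2 e) (Theta p v).
Proof.
  intros He. destruct (unit_contact_coords p e He) as [H3 H1].
  destruct p as [[p1 p2] p3], e as [[C S] z], v as [[a b] c]. triple. subst z.
  assert (H : C * C = 1 - S * S) by lra.
  f_equal; [f_equal |]; ring [H].
Qed.

Lemma Theta_comb (p e : R3) (a b c : R) :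
  unit_contact p e -> Theta p (comb p e a b c) = c.
Proof. intros He. apply (comb_coords p e a b c He). Qed.

Lemma vec_comb (p e v : R3) (u w tau c d : R) :
  v = comb p e u w tau ->
  vadd (vscale c e) (vscale d v) = comb p e (c + d * u) (d * w) (d * tau).
Proof.
  intros ->. destruct p as [[p1 p2] p3], e as [[C S] z]. triple.
  f_equal; [f_equal |]; ring.
Qed.

(** The coefficients of [F_t] in the frame carried by the unit contact vector
    [F_s] determine everything pointwise: if [F] is immersed at the point, the
    point is regular iff [tau] is nonzero, and then alpha is [w / tau], [a] is
    [- u / (tau * sqrt (1 + alpha ^ 2))] and [b] is
    [/ (tau * sqrt (1 + alpha ^ 2))]. *)
Definition adapted (F : surface) (s t u w tau : R) : Prop :=
  unit_contact (F s t) (d_s F s t) /\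
  d_t F s t = comb (F s t) (d_s F s t) u w tau.

Lemma is_e1_adapted (F e1 : surface) (s t u w tau : R) :
  adapted F s t u w tau -> e1 s t = d_s F s t -> is_e1 F s t (e1 s t).
Proof.
  intros [[H1 H2] _] ->. split; [| split; assumption].
  exists 1, 0. destruct (d_s F s t) as [[a b] c], (d_t F s t) as [[a' b'] c'].
  triple. f_equal; [f_equal |]; ring.
Qed.

(** If [tau] vanished, [F_s] and [F_t] would be two independent vectors of the
    contact plane, which would then be the tangent plane. *)
Lemma regular_transverse (F : surface) (s t u w tau : R) :
  adapted F s t u w tau ->
  (forall c d, vadd (vscale c (d_s F s t)) (vscale d (d_t F s t)) = (0, 0, 0) ->
     c = 0 /\ d = 0) ->
  regular F s t -> tau <> 0.
Proof.
  intros [Hu Ht] Hind Hreg Htau. subst tau. apply Hreg. intros v.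
  assert (Hw : w <> 0).
  { intros ->. destruct (Hind (- u) 1) as [_ H]; [| lra].
    rewrite (vec_comb _ _ _ _ _ _ _ _ Ht).
    destruct (F s t) as [[? ?] ?], (d_s F s t) as [[? ?] ?]. triple.
    f_equal; [f_equal |]; ring. }
  split.
  - intros (c & d & ->). unfold contact.
    rewrite (vec_comb _ _ _ _ _ _ _ _ Ht), Theta_comb; auto. ring.
  - intros Hv. rewrite (comb_decomp _ _ v Hu), Hv.
    set (a := _ + _). set (b := _ - _).
    exists (a - b / w * u), (b / w). rewrite (vec_comb _ _ _ _ _ _ _ _ Ht).
    f_equal; field; exact Hw.
Qed.

Lemma transverse_regular (F : surface) (s t u w tau : R) :
  adapted F s t u w tau -> tau <> 0 -> regular F s t.
Proof.
  intros [Hu Ht] Htau H. apply Htau.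
  rewrite <- (Theta_comb _ _ u w tau Hu). apply H.
  exists 0, 1. rewrite (vec_comb _ _ _ _ _ _ _ _ Ht). f_equal; ring.
Qed.

Lemma e2_comb (F e1 : surface) (s t al : R) :
  e1 s t = d_s F s t ->
  vadd (vscale al (e2 F e1 s t)) (ET (F s t)) = comb (F s t) (d_s F s t) 0 al 1.
Proof.
  intros E. unfold e2. rewrite E.
  destruct (F s t) as [[? ?] ?], (d_s F s t) as [[? ?] ?]. triple.
  f_equal; [f_equal |]; ring.
Qed.

(** Among the tangent vectors [c F_s + d F_t], those without [e1]-component
    and with unit [T]-component have [d = / tau], which leaves [w / tau] for
    the [e2]-component. *)
Lemma is_alpha_adapted (F e1 : surface) (s t u w tau al : R) :
  adapted F s t u w tau -> e1 s t = d_s F s t -> tau <> 0 ->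
  is_alpha F e1 s t al <-> al = w / tau.
Proof.
  intros [Hu Ht] E Htau. unfold is_alpha, tangent. rewrite (e2_comb _ _ _ _ _ E).
  split.
  - intros (c & d & H). rewrite (vec_comb _ _ _ _ _ _ _ _ Ht) in H.
    apply comb_inj in H; [| exact Hu]. destruct H as (_ & -> & H).
    apply (Rmult_eq_reg_r tau); [| exact Htau].
    replace (w / tau * tau) with w by (field; exact Htau).
    replace (d * w * tau) with (w * (d * tau)) by ring. rewrite <- H. ring.
  - intros ->. exists (- (u / tau)), (/ tau).
    rewrite (vec_comb _ _ _ _ _ _ _ _ Ht). f_equal; field; exact Htau.
Qed.

Lemma sqrt_1_sqr_pos (al : R) : 0 < sqrt (1 + al ^ 2).
Proof. apply sqrt_lt_R0. assert (H := pow2_ge_0 al). lra. Qed.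

Lemma is_ab_adapted (F e1 : surface) (s t u w tau al a b : R) :
  adapted F s t u w tau -> e1 s t = d_s F s t -> tau <> 0 -> al = w / tau ->
  is_ab F e1 s t al a b <->
  a = - u / (tau * sqrt (1 + al ^ 2)) /\ b = / (tau * sqrt (1 + al ^ 2)).
Proof.
  intros [Hu Ht] E Htau Hal. unfold is_ab, e2hat.
  rewrite (e2_comb _ _ _ _ _ E), (vec_comb _ _ _ _ _ _ _ _ Ht).
  assert (Hr := sqrt_1_sqr_pos al). set (r := sqrt _) in *.
  assert (Hr0 : r <> 0) by lra.
  replace (vscale (/ r) (comb (F s t) (d_s F s t) 0 al 1))
    with (comb (F s t) (d_s F s t) 0 (al / r) (/ r)).
  2: { destruct (F s t) as [[? ?] ?], (d_s F s t) as [[? ?] ?]. triple.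
       f_equal; [f_equal |]; field; exact Hr0. }
  split.
  - intros H. apply comb_inj in H; [| exact Hu]. destruct H as (H1 & _ & H3).
    assert (Hb : b = / (tau * r)).
    { apply (Rmult_eq_reg_r tau); [| exact Htau]. rewrite <- H3. field; auto. }
    split; [| exact Hb]. rewrite Hb in H1.
    replace (- u / (tau * r)) with (- (/ (tau * r) * u)) by (field; auto). lra.
  - intros [-> ->]. rewrite Hal. f_equal; field; auto.
Qed.

(** * Surfaces in changed coordinates *)

Lemma d_s_shear (F : surface) (K g : R -> R) (s t : R) :
  d_s (shear K g F) s t = shear K g (d_s F) s t.
Proof.
  change (shear K g (d_s F) s t) with (d_s F (s - K t) (g t)). unfold d_s.
  apply f_equal2; [apply f_equal2 |].
  - exact (Derive_shear_s (fun x y => c1 (F x y)) K g s t).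
  - exact (Derive_shear_s (fun x y => c2 (F x y)) K g s t).
  - exact (Derive_shear_s (fun x y => c3 (F x y)) K g s t).
Qed.

Lemma d_t_shear (U : R -> R -> Prop) (F : surface) (K g : R -> R)
    (s t dK dg : R) :
  immersion_on U F -> U (s - K t) (g t) ->
  is_derive K t dK -> is_derive g t dg ->
  d_t (shear K g F) s t =
    vadd (vscale dg (shear K g (d_t F) s t)) (vscale (- dK) (shear K g (d_s F) s t)).
Proof.
  intros (HU & C1 & C2 & C3 & _) Hst HK Hg.
  set (Fs := d_s F (s - K t) (g t)). set (Ft := d_t F (s - K t) (g t)).
  transitivity (dg * c1 Ft - dK * c1 Fs, dg * c2 Ft - dK * c2 Fs,
    dg * c3 Ft - dK * c3 Fs).
  - unfold d_t. apply f_equal2; [apply f_equal2 |]; apply is_derive_unique.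
    + exact (is_derive_shear U _ K g s t dK dg HU C1 Hst HK Hg).
    + exact (is_derive_shear U _ K g s t dK dg HU C2 Hst HK Hg).
    + exact (is_derive_shear U _ K g s t dK dg HU C3 Hst HK Hg).
  - unfold shear. fold Fs Ft. unfold vadd, vscale. cbv [c1 c2 c3 fst snd].
    f_equal; [f_equal |]; ring.
Qed.

(** The new [F_t'] is [dg F_t - dK F_s], so that a change of coordinates acts on
    the three coefficients affinely; in particular alpha, which is [w / tau], is
    invariant. *)
Lemma adapted_shear (U : R -> R -> Prop) (F : surface) (K g : R -> R)
    (s t dK dg u w tau : R) :
  immersion_on U F -> U (s - K t) (g t) ->
  is_derive K t dK -> is_derive g t dg ->
  adapted F (s - K t) (g t) u w tau ->
  adapted (shear K g F) s t (dg * u - dK) (dg * w) (dg * tau).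
Proof.
  intros HF Hst HK Hg [Hu Ht]. split; rewrite d_s_shear; [exact Hu |].
  rewrite (d_t_shear U F K g s t dK dg HF Hst HK Hg).
  unfold shear. rewrite Ht.
  destruct (F (s - K t) (g t)) as [[? ?] ?], (d_s F (s - K t) (g t)) as [[? ?] ?].
  triple. f_equal; [f_equal |]; ring.
Qed.

Lemma immersion_on_shear (U W : R -> R -> Prop) (F : surface)
    (K g dK dg : R -> R) :
  immersion_on U F -> open2 W ->
  (forall s t, W s t -> U (s - K t) (g t)) ->
  (forall s t, W s t -> is_derive K t (dK t) /\ is_derive g t (dg t) /\
     continuous dK t /\ continuous dg t) ->
  (forall s t, W s t -> dg t <> 0) ->
  immersion_on W (shear K g F).
Proof.
  intros HF HW HWU Hd Hdg.
  assert (HF' := HF). destruct HF' as (HU & C1 & C2 & C3 & Hi).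
  split; [exact HW |].
  split; [exact (C1_on_shear U W _ K g dK dg HU HW C1 HWU Hd) |].
  split; [exact (C1_on_shear U W _ K g dK dg HU HW C2 HWU Hd) |].
  split; [exact (C1_on_shear U W _ K g dK dg HU HW C3 HWU Hd) |].
  intros s t Hst c d E.
  destruct (Hd s t Hst) as (D1 & D2 & _).
  specialize (Hdg s t Hst). specialize (HWU s t Hst).
  rewrite d_s_shear, (d_t_shear U F K g s t _ _ HF HWU D1 D2) in E.
  destruct (Hi _ _ HWU (c - d * dK t) (d * dg t)) as [H1 H2].
  - rewrite <- E. unfold shear.
    destruct (d_s F (s - K t) (g t)) as [[? ?] ?], (d_t F (s - K t) (g t)) as [[? ?] ?].
    triple. f_equal; [f_equal |]; ring.
  - assert (Hd0 : d = 0).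
    { apply Rmult_integral in H2. tauto. }
    subst d. split; lra.
Qed.

Lemma is_nabla_shear (F X : surface) (K g : R -> R) (s t : R) (Z : R3) :
  is_nabla F X (s - K t) (g t) 1 0 Z ->
  is_nabla (shear K g F) (shear K g X) s t 1 0 Z.
Proof.
  intros (H1 & H2 & H3). unfold is_nabla, shear.
  assert (E : forall r, frame (F (s - K t + r * 1) (g t + r * 0))
        (X (s - K t + r * 1) (g t + r * 0))
      = frame (F (s + r * 1 - K (t + r * 0)) (g (t + r * 0)))
        (X (s + r * 1 - K (t + r * 0)) (g (t + r * 0)))).
  { intros r. rewrite !Rmult_0_r, !Rplus_0_r.
    now replace (s - K t + r * 1) with (s + r * 1 - K t) by ring. }
  split; [| split].
  - exact (is_derive_ext _ _ _ _ (fun r => f_equal c1 (E r)) H1).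
  - exact (is_derive_ext _ _ _ _ (fun r => f_equal c2 (E r)) H2).
  - exact (is_derive_ext _ _ _ _ (fun r => f_equal c3 (E r)) H3).
Qed.

(** [b] has the sign of [tau], being [/ (tau * sqrt (1 + alpha ^ 2))]. *)
Lemma regular_part_adapted (eps : R) (U : R -> R -> Prop) (F e1 : surface)
    (s t u w tau : R) :
  immersion_on U F -> U s t -> adapted F s t u w tau -> e1 s t = d_s F s t ->
  regular_part eps U F e1 s t <-> 0 < eps * tau.
Proof.
  intros (_ & _ & _ & _ & Hi) Hst Had E. split.
  - intros (_ & Hreg & al & a & b & Hal & Hab & Hb).
    assert (Htau : tau <> 0)
      by (eapply regular_transverse; [exact Had | exact (Hi _ _ Hst) | exact Hreg]).
    apply (is_alpha_adapted _ _ _ _ _ _ _ _ Had E Htau) in Hal.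
    apply (is_ab_adapted _ _ _ _ _ _ _ _ _ _ Had E Htau Hal) in Hab.
    destruct Hab as [_ ->].
    assert (Hr := sqrt_1_sqr_pos al). set (r := sqrt _) in *.
    replace (eps * tau) with (eps * / (tau * r) * (r * (tau * tau)))
      by (field; split; lra).
    apply Rmult_lt_0_compat; [exact Hb |].
    apply Rmult_lt_0_compat; [exact Hr |].
    assert (H := Rsqr_pos_lt tau Htau). exact H.
  - intros Hpos.
    assert (Htau : tau <> 0) by (intros H; rewrite H, Rmult_0_r in Hpos; lra).
    split; [exact Hst |]. split; [eapply transverse_regular; eauto |].
    exists (w / tau).
    assert (Hr := sqrt_1_sqr_pos (w / tau)). set (r := sqrt _) in *.
    exists (- u / (tau * r)), (/ (tau * r)).
    split; [eapply is_alpha_adapted; eauto |].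
    split; [eapply is_ab_adapted; eauto |].
    replace (eps * / (tau * r)) with (eps * tau * / (tau * tau * r))
      by (field; split; lra).
    apply Rmult_lt_0_compat; [exact Hpos |]. apply Rinv_0_lt_compat.
    apply Rmult_lt_0_compat; [| exact Hr]. exact (Rsqr_pos_lt tau Htau).
Qed.

(** This function is [tau]; its continuity is what makes the two oriented
    regular parts open. *)
Lemma continuity_2d_Theta_d_t (U : R -> R -> Prop) (F : surface) (s t : R) :
  immersion_on U F -> U s t ->
  continuity_2d_pt (fun x y => Theta (F x y) (d_t F x y)) s t.
Proof.
  intros (HU & C1 & C2 & C3 & _) Hst. unfold Theta, d_t.
  apply continuity_2d_pt_minus; [apply continuity_2d_pt_plus |].
  - apply (C3 s t Hst).
  - apply continuity_2d_pt_mult; [| apply (C2 s t Hst)].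
    exact (C1_on_continuity_2d U _ s t HU C1 Hst).
  - apply continuity_2d_pt_mult; [| apply (C1 s t Hst)].
    exact (C1_on_continuity_2d U _ s t HU C2 Hst).
Qed.

(** * The deformed Pansu sphere *)

(** The s-curves are left translates of the rotated generating curve of the Pansu
    sphere, a geodesic whose projection is traversed with direction angle
    [2 * lambda * s]; rotation adds [th] to the angle. *)
Lemma d_s_deformed (lambda : R) (x1 x2 x3 : R -> R) (s th : R) :
  lambda <> 0 ->
  let Y := deformed lambda x1 x2 x3 in
  let phi := 2 * lambda * s + th in
  d_s Y s th = (cos phi, sin phi, c2 (Y s th) * cos phi - c1 (Y s th) * sin phi).
Proof.
  intros Hl Y phi. unfold d_s, Y, phi, deformed, Hmul, rot, pansu.
  cbv [c1 c2 c3 fst snd].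
  assert (Hs := sin2_cos2 (2 * lambda * s)). assert (Ht := sin2_cos2 th).
  unfold Rsqr in Hs, Ht. rewrite cos_plus, sin_plus.
  repeat (apply f_equal2); apply is_derive_unique; (auto_derive; [exact I |]).
  - field; exact Hl.
  - field; exact Hl.
  - assert (Hs' : sin (2 * lambda * s) * sin (2 * lambda * s)
      = 1 - cos (2 * lambda * s) * cos (2 * lambda * s)) by lra.
    assert (Ht' : sin th * sin th = 1 - cos th * cos th) by lra.
    clear Hs Ht. set (c := cos _) in *. set (d := sin _) in *.
    field [Hs' Ht']; exact Hl.
Qed.

Lemma unit_contact_angle (p : R3) (phi : R) :
  unit_contact p (cos phi, sin phi, c2 p * cos phi - c1 p * sin phi).
Proof.
  assert (H := sin2_cos2 phi). unfold Rsqr in H.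
  split; [unfold contact | unfold metric, frame]; triple; [ring | nra].
Qed.

(** [B] and [A] are the components of the projection of the derivative of the
    curve along the directions of angle [th] and [th + PI / 2]. The frame vector
    [e1] makes the angle [2 * lambda * s] with the former, so that the
    coefficients are trigonometric in [2 * lambda * s] with coefficients
    [A] and [1 / (2 * lambda) - B]. *)
Lemma adapted_deformed (lambda : R) (x1 x2 x3 : R -> R) (s th : R) :
  lambda <> 0 -> ex_derive x1 th -> ex_derive x2 th -> ex_derive x3 th ->
  let A := funA x1 x2 th in
  let B' := 1 / (2 * lambda) - funB x1 x2 th in
  let sn := sin (2 * lambda * s) in
  let cs := cos (2 * lambda * s) in
  adapted (deformed lambda x1 x2 x3) s th
    (1 / (2 * lambda) - (cs * B' - sn * A)) (sn * B' + cs * A)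
    ((funD lambda x1 x2 x3 th - (cs * B' - sn * A)) / lambda).
Proof.
  intros Hl D1 D2 D3 A B' sn cs.
  assert (Hu : unit_contact (deformed lambda x1 x2 x3 s th)
    (d_s (deformed lambda x1 x2 x3) s th)).
  { rewrite d_s_deformed; [apply unit_contact_angle | exact Hl]. }
  split; [exact Hu |].
  rewrite (comb_decomp _ _ (d_t (deformed lambda x1 x2 x3) s th) Hu).
  assert (Hd : d_t (deformed lambda x1 x2 x3) s th =
    let P := c1 (rot th (pansu lambda s)) in
    let Q := c2 (rot th (pansu lambda s)) in
    (Derive x1 th - Q, Derive x2 th + P,
     Derive x3 th + Derive x2 th * P - x2 th * Q - Derive x1 th * Q - x1 th * P)).
  { unfold d_t, deformed, Hmul, rot, pansu. cbv [c1 c2 c3 fst snd].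
    repeat (apply f_equal2); apply is_derive_unique;
      (auto_derive; [repeat split; assumption |]);
      change (fun x : R => x1 x) with x1; change (fun x : R => x2 x) with x2;
      change (fun x : R => x3 x) with x3; ring. }
  rewrite Hd, d_s_deformed by exact Hl.
  unfold A, B', funD, funA, funB, deformed, Hmul, rot, pansu.
  cbv [Theta c1 c2 c3 fst snd]. rewrite cos_plus, sin_plus.
  assert (Hs := sin2_cos2 (2 * lambda * s)). assert (Ht := sin2_cos2 th).
  unfold Rsqr in Hs, Ht. fold sn cs. fold sn cs in Hs.
  assert (Hs' : sn * sn = 1 - cs * cs) by lra.
  assert (Ht' : sin th * sin th = 1 - cos th * cos th) by lra.
  clear Hs Ht Hd.
  f_equal; field [Hs' Ht']; exact Hl.
Qed.

(** Along an s-curve [e2] is the unit vector of angle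
    [2 * lambda * s + th + PI / 2] in the parallel frame: differentiating it
    gives [- 2 * lambda] times [e1], so that [H] is [2 * lambda]. *)
Lemma is_nabla_deformed (lambda : R) (x1 x2 x3 : R -> R) (s th : R) :
  lambda <> 0 ->
  let Y := deformed lambda x1 x2 x3 in
  is_nabla Y (e2 Y (d_s Y)) s th 1 0 (vscale (- (2 * lambda)) (d_s Y s th)).
Proof.
  intros Hl Y.
  assert (E : forall r, frame (Y (s + r * 1) (th + r * 0))
      (e2 Y (d_s Y) (s + r * 1) (th + r * 0))
    = (- sin (2 * lambda * (s + r) + th), cos (2 * lambda * (s + r) + th), 0)).
  { intros r. rewrite Rmult_0_r, Rplus_0_r, Rmult_1_r. unfold e2, Y.
    rewrite d_s_deformed by exact Hl. fold Y.
    destruct (Y (s + r) th) as [[? ?] ?]. unfold frame. triple.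
    f_equal; [f_equal |]; ring. }
  unfold is_nabla, Y. rewrite d_s_deformed by exact Hl. fold Y.
  split; [| split].
  - apply (is_derive_ext _ _ _ _ (fun r => eq_sym (f_equal c1 (E r)))).
    destruct (Y s th) as [[? ?] ?]. unfold frame. triple.
    auto_derive; trivial; rewrite ?Rplus_0_r; ring.
  - apply (is_derive_ext _ _ _ _ (fun r => eq_sym (f_equal c2 (E r)))).
    destruct (Y s th) as [[? ?] ?]. unfold frame. triple.
    auto_derive; trivial; rewrite ?Rplus_0_r; ring.
  - apply (is_derive_ext _ _ _ _ (fun r => eq_sym (f_equal c3 (E r)))).
    destruct (Y s th) as [[? ?] ?]. unfold frame. triple.
    auto_derive; trivial; rewrite ?Rplus_0_r; ring.
Qed.

(** * The normal coordinates *)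

Lemma continuous_coefficients (lambda : R) (l r : Rbar) (x1 x2 x3 : R -> R) (th : R) :
  C1_curve_on (Interval l r) x1 -> C1_curve_on (Interval l r) x2 ->
  C1_curve_on (Interval l r) x3 -> Interval l r th ->
  continuous (funD lambda x1 x2 x3) th /\
  continuous (fun u => norm2 (funV lambda x1 x2 u)) th.
Proof.
  intros H1 H2 H3 Hth.
  destruct (H1 th Hth) as [[d1 D1] C1], (H2 th Hth) as [[d2 D2] C2],
    (H3 th Hth) as [_ C3].
  apply is_derive_continuous in D1. apply is_derive_continuous in D2.
  assert (Cc := continuous_cos th). assert (Cs := continuous_sin th).
  apply continuity_pt_filterlim in C1. apply continuity_pt_filterlim in C2.
  apply continuity_pt_filterlim in C3. apply continuity_pt_filterlim in D1.
  apply continuity_pt_filterlim in D2. apply continuity_pt_filterlim in Cc.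
  apply continuity_pt_filterlim in Cs.
  assert (CA : continuity_pt (funA x1 x2) th).
  { exact (continuity_pt_minus _ _ _ (continuity_pt_mult _ _ _ C2 Cc)
      (continuity_pt_mult _ _ _ C1 Cs)). }
  assert (CB : continuity_pt (funB x1 x2) th).
  { exact (continuity_pt_plus _ _ _ (continuity_pt_mult _ _ _ C2 Cs)
      (continuity_pt_mult _ _ _ C1 Cc)). }
  assert (Cst : forall k : R, continuity_pt (fun _ => k) th)
    by (intros k; apply continuity_pt_const; intros x y; reflexivity).
  split.
  - apply continuity_pt_filterlim.
    refine (continuity_pt_minus (fun u => lambda * Theta (x1 u, x2 u, x3 u)
      (Derive x1 u, Derive x2 u, Derive x3 u) + 1 / (2 * lambda)) _ _ _ CB).
    refine (continuity_pt_plus _ _ _ (continuity_pt_mult _ _ _ (Cst lambda) _)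
      (Cst (1 / (2 * lambda)))).
    exact (continuity_pt_minus _ _ _ (continuity_pt_plus _ _ _ C3
      (continuity_pt_mult _ _ _ D1 C2)) (continuity_pt_mult _ _ _ D2 C1)).
  - apply (continuous_comp (fun u => fst (funV lambda x1 x2 u) ^ 2
      + snd (funV lambda x1 x2 u) ^ 2) sqrt); [| apply continuous_sqrt].
    apply continuity_pt_filterlim.
    assert (CV := continuity_pt_minus _ _ _ (Cst (1 / (2 * lambda))) CB).
    exact (continuity_pt_plus _ _ _
      (continuity_pt_mult _ _ _ CA (continuity_pt_mult _ _ _ CA (Cst 1)))
      (continuity_pt_mult _ _ _ CV (continuity_pt_mult _ _ _ CV (Cst 1)))).
Qed.

Lemma norm2_pos (v : R * R) : v <> (0, 0) -> 0 < norm2 v.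
Proof.
  destruct v as [a b]. intros H. unfold norm2. simpl fst. simpl snd.
  apply sqrt_lt_R0.
  assert (Ha := pow2_ge_0 a). assert (Hb := pow2_ge_0 b).
  destruct (Req_dec a 0) as [-> |]; [destruct (Req_dec b 0) as [-> |] |].
  - now elim H.
  - assert (0 < b ^ 2) by now apply pow2_gt_0. lra.
  - assert (0 < a ^ 2) by now apply pow2_gt_0. lra.
Qed.

(** Writing [V] in polar form combines the sine and cosine terms into one phase
    [psi]; the quotient [w / tau] is then the normal form of alpha. *)
Lemma adapted_deformed_polar (lambda : R) (x1 x2 x3 : R -> R) (s th zeta : R) :
  lambda <> 0 -> ex_derive x1 th -> ex_derive x2 th -> ex_derive x3 th ->
  let V := funV lambda x1 x2 th in
  V <> (0, 0) ->
  (fst V / norm2 V, snd V / norm2 V) = (sin zeta, cos zeta) ->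
  let psi := 2 * lambda * s + zeta in
  adapted (deformed lambda x1 x2 x3) s th
    (1 / (2 * lambda) - norm2 V * cos psi) (norm2 V * sin psi)
    (norm2 V / lambda * (funG lambda x1 x2 x3 th - cos psi)).
Proof.
  intros Hl D1 D2 D3 V HV HVz psi.
  assert (HN := norm2_pos V HV). injection HVz. intros Hc Hs.
  assert (HA : funA x1 x2 th = norm2 V * sin zeta).
  { rewrite <- Hs. field. lra. }
  assert (HB : 1 / (2 * lambda) - funB x1 x2 th = norm2 V * cos zeta).
  { rewrite <- Hc. field. split; lra. }
  assert (Had := adapted_deformed lambda x1 x2 x3 s th Hl D1 D2 D3).
  cbv zeta in Had. rewrite HA, HB in Had.
  unfold psi, funG. fold V. rewrite cos_plus, sin_plus.
  set (N := norm2 V) in *. set (D := funD lambda x1 x2 x3 th) in *.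
  set (cs := cos (2 * lambda * s)) in *. set (sn := sin (2 * lambda * s)) in *.
  replace (N / lambda * (D / N - (cs * cos zeta - sn * sin zeta)))
    with ((D - (cs * (N * cos zeta) - sn * (N * sin zeta))) / lambda)
    by (field; split; lra).
  replace (1 / (2 * lambda) - N * (cs * cos zeta - sn * sin zeta))
    with (1 / (2 * lambda) - (cs * (N * cos zeta) - sn * (N * sin zeta))) by ring.
  replace (N * (sn * cos zeta + cs * sin zeta))
    with (sn * (N * cos zeta) + cs * (N * sin zeta)) by ring.
  exact Had.
Qed.

(** Zeros of the sine are isolated, so alpha vanishes identically near no point. *)
Lemma sin_nonzero_nearby (k psi d : R) :
  0 < k -> 0 < d -> exists h, 0 <= h < d /\ sin (k * h + psi) <> 0.
Proof.
  intros Hk Hd.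
  destruct (Req_dec (sin psi) 0) as [H0 |].
  - set (h := Rmin (d / 2) (PI / (2 * k))).
    assert (HPI := PI_RGT_0).
    assert (Hp : 0 < PI / (2 * k)) by (apply Rdiv_lt_0_compat; lra).
    assert (Hh : 0 < h) by (apply Rmin_pos; lra).
    assert (Hh1 := Rmin_l (d / 2) (PI / (2 * k))).
    assert (Hh2 := Rmin_r (d / 2) (PI / (2 * k))). fold h in Hh1, Hh2.
    exists h. split; [lra |].
    rewrite sin_plus, H0, Rmult_0_r, Rplus_0_r.
    assert (Hkh : k * h <= PI / 2).
    { apply (Rmult_le_compat_l k) in Hh2; [| lra].
      replace (k * (PI / (2 * k))) with (PI / 2) in Hh2 by (field; lra). lra. }
    assert (0 < sin (k * h)).
    { apply sin_gt_0; [now apply Rmult_lt_0_compat | lra]. }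
    assert (Hcs := sin2_cos2 psi). unfold Rsqr in Hcs. rewrite H0 in Hcs.
    intros E. apply Rmult_integral in E. destruct E as [E | E]; [lra |].
    rewrite E in Hcs. lra.
  - exists 0. split; [lra |]. now rewrite Rmult_0_r, Rplus_0_l.
Qed.

(** Let [g] be the inverse of [Phi] and [dg] its derivative. In the new
    coordinates the coefficient [u] becomes [dg * (u - Gamma')], and
    [u - Gamma' = D - N cos psi = N * (G - cos psi)], while
    [tau] becomes [dg * N / lambda * (G - cos psi)]: the choice of [Gamma] makes
    their ratio the constant [lambda], which is the normal form of [a], and the
    choice of [Phi' = eps * 2 * lambda * N] turns [b] into its normal form, the
    sign [eps] matching the absolute value there. *)
Lemma normal_change_deformed (lambda eps : R) (l r : Rbar) (x1 x2 x3 : R -> R)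
    (U : R -> R -> Prop) (zeta int_D Phi : R -> R) :
  let Y := deformed lambda x1 x2 x3 in
  let V := funV lambda x1 x2 in
  let Gamma th := th / (2 * lambda) - int_D th in
  0 < lambda -> eps * eps = 1 ->
  C1_curve_on (Interval l r) x1 -> C1_curve_on (Interval l r) x2 ->
  C1_curve_on (Interval l r) x3 ->
  (forall s th, U s th -> Interval l r th) -> immersion_on U Y ->
  (forall th, Interval l r th -> V th <> (0, 0)) ->
  (forall th, Interval l r th ->
     (fst (V th) / norm2 (V th), snd (V th) / norm2 (V th))
     = (sin (zeta th), cos (zeta th))) ->
  (forall th, Interval l r th -> is_derive int_D th (funD lambda x1 x2 x3 th)) ->
  (forall th, Interval l r th ->
     is_derive Phi th (eps * (2 * lambda * norm2 (V th)))) ->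
  normal_change lambda (Interval l r) (regular_part eps U Y (d_s Y)) Y (d_s Y)
    Gamma Phi (fun th => zeta th - 2 * lambda * Gamma th)
    (funG lambda x1 x2 x3).
Proof.
  intros Y V Gamma Hl Heps C1 C2 C3 HUI HY HV HVz HD HPhi.
  set (I := Interval l r) in *.
  set (N := fun th => norm2 (V th)).
  set (D := funD lambda x1 x2 x3). set (G := funG lambda x1 x2 x3).
  assert (Hl0 : lambda <> 0) by lra.
  assert (He0 : eps <> 0) by (intros E; rewrite E in Heps; lra).
  assert (HN : forall th, I th -> 0 < N th) by (intros th Hth; apply norm2_pos, HV, Hth).
  assert (HG : forall th, I th -> N th * G th = D th).
  { intros th Hth. unfold G, funG. fold D. fold (V th). fold (N th).
    field. specialize (HN th Hth). lra. }
  assert (HYad : forall s th, I th ->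
    let psi := 2 * lambda * s + zeta th in
    adapted Y s th (1 / (2 * lambda) - N th * cos psi) (N th * sin psi)
      (N th / lambda * (G th - cos psi))).
  { intros s th Hth. apply adapted_deformed_polar; auto.
    - apply C1, Hth.
    - apply C2, Hth.
    - apply C3, Hth. }
  destruct (monotone_inverse eps l r Phi
    (fun th => eps * (2 * lambda * N th)) Heps HPhi) as [g Hg].
  { intros th Hth. rewrite <- Rmult_assoc, Heps.
    specialize (HN th Hth).
    assert (0 < lambda * N th) by now apply Rmult_lt_0_compat. lra. }
  exists g. split; [intros th Hth; apply Hg, Hth |].
  set (K := fun t => Gamma (g t)).
  set (dg := fun t => / (eps * (2 * lambda * N (g t)))).
  set (dK := fun t => (1 / (2 * lambda) - D (g t)) * dg t).
  set (RP := regular_part eps U Y (d_s Y)).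
  set (W := fun s' t' => exists s th, RP s th /\ s' = s + Gamma th /\ t' = Phi th).
  (* On the image of the regular part the old parameters of (s', t') are
     s' - K t' and g t'. *)
  assert (HW : forall s' t', W s' t' ->
    I (g t') /\ Phi (g t') = t' /\ RP (s' - K t') (g t')).
  { intros s' t' (s & th & HRP & -> & ->).
    assert (Hth : I th) by (apply (HUI s); apply HRP).
    destruct (Hg th Hth) as (E & _). unfold K. rewrite E.
    replace (s + Gamma th - Gamma th) with s by ring. auto. }
  assert (HRPiff : forall s th, U s th ->
    (RP s th <-> 0 < eps * (N th / lambda * (G th - cos (2 * lambda * s + zeta th))))).
  { intros s th Hst.
    exact (regular_part_adapted eps U Y (d_s Y) s th _ _ _ HY Hst
      (HYad s th (HUI s th Hst)) eq_refl). }
  assert (HWU : forall s' t', W s' t' -> U (s' - K t') (g t')).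
  { intros s' t' H. apply (HW s' t' H). }
  assert (Hdg : forall t', I (g t') -> 0 < eps * dg t').
  { intros t' H. unfold dg. specialize (HN _ H).
    replace (eps * / (eps * (2 * lambda * N (g t'))))
      with (/ (2 * lambda * N (g t'))) by (field; repeat split; lra).
    apply Rinv_0_lt_compat. apply Rmult_lt_0_compat; lra. }
  assert (Hdg0 : forall t', I (g t') -> dg t' <> 0).
  { intros t' H E. specialize (Hdg t' H). rewrite E in Hdg. lra. }
  assert (Hder : forall t', I (g t') -> Phi (g t') = t' ->
    is_derive K t' (dK t') /\ is_derive g t' (dg t') /\
    continuous dK t' /\ continuous dg t').
  { intros t' Hth Ht. destruct (Hg _ Hth) as (_ & _ & Dg). rewrite Ht in Dg.
    fold (dg t') in Dg.
    assert (Cg := is_derive_continuous _ _ _ Dg).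
    destruct (continuous_coefficients lambda l r x1 x2 x3 (g t') C1 C2 C3 Hth)
      as [CD CN]. fold D in CD.
    assert (Cdg : continuous dg t').
    { apply (continuous_comp (fun t => eps * (2 * lambda * N (g t))) Rinv).
      - apply (continuous_scal_r (V := R_NormedModule) eps).
        apply (continuous_scal_r (V := R_NormedModule) (2 * lambda)).
        apply (continuous_comp g N); [exact Cg | exact CN].
      - apply continuous_Rinv. specialize (HN _ Hth).
        apply Rmult_integral_contrapositive_currified; [exact He0 |].
        apply Rmult_integral_contrapositive_currified; lra. }
    split; [| split; [exact Dg | split; [| exact Cdg]]].
    - unfold K, dK. rewrite Rmult_comm.
      apply (is_derive_comp Gamma g); [| exact Dg].
      assert (DD := HD _ Hth). fold D in DD. unfold Gamma.
      apply (is_derive_minus (V := R_NormedModule) (fun th => th / (2 * lambda)) int_D);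
        [| exact DD].
      auto_derive; [trivial |]. field. exact Hl0.
    - apply (continuous_mult (K := R_AbsRing)); [| exact Cdg].
      apply (continuous_minus (V := R_NormedModule)); [apply continuous_const |].
      apply (continuous_comp g D); [exact Cg | exact CD]. }
  assert (HWder : forall s' t', W s' t' ->
    is_derive K t' (dK t') /\ is_derive g t' (dg t') /\
    continuous dK t' /\ continuous dg t').
  { intros s' t' H. destruct (HW _ _ H) as (H1 & H2 & _). now apply Hder. }
  assert (HRPopen : open2 RP).
  { intros s th HRP. assert (Hst : U s th) by apply HRP.
    assert (tauE : forall x y, U x y -> Theta (Y x y) (d_t Y x y)
      = N y / lambda * (G y - cos (2 * lambda * x + zeta y))).
    { intros x y Hxy. destruct (HYad x y (HUI x y Hxy)) as [Hu ->].
      now apply Theta_comb. }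
    assert (Hc : continuity_2d_pt (fun x y => eps * Theta (Y x y) (d_t Y x y)) s th).
    { apply continuity_2d_pt_mult; [apply continuity_2d_pt_const |].
      apply (continuity_2d_Theta_d_t U); assumption. }
    apply continuity_2d_pt_filterlim in Hc.
    assert (Hp : locally (eps * Theta (Y s th) (d_t Y s th)) (fun v => 0 < v)).
    { apply (open_gt 0). rewrite (tauE _ _ Hst). now apply HRPiff. }
    assert (Hq := Hc _ Hp).
    assert (HUo := proj1 HY s th Hst). apply locally_2d_locally in HUo.
    apply locally_2d_locally.
    generalize (filter_and _ _ HUo Hq). apply filter_imp.
    intros [x y] [Hxy Hpos]. simpl in *.
    apply HRPiff; [exact Hxy |]. now rewrite <- tauE. }
  assert (HWopen : open2 W).
  { intros s' t' H. destruct (HW _ _ H) as (Hth & Ht & HRP).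
    destruct (HWder _ _ H) as (DK & Dg & _).
    assert (L1 := locally_2d_shear RP K g s' t' (HRPopen _ _ HRP)
      (is_derive_continuous _ _ _ DK) (is_derive_continuous _ _ _ Dg)).
    destruct (Hg _ Hth) as (_ & L2 & _). rewrite Ht in L2.
    assert (L3 : locally_2d (fun _ v => I (g v) /\ Phi (g v) = v) s' t').
    { destruct L2 as [d L2]. exists d. intros u v _ Hv. apply L2. exact Hv. }
    generalize (locally_2d_and _ _ _ _ L1 L3). apply locally_2d_impl, locally_2d_forall.
    intros u v [HR [_ Hv]]. exists (u - K v), (g v). unfold K.
    repeat split; [apply HR | apply HR | apply HR | ring | now rewrite Hv]. }
  assert (HE1 : forall s' t', shear K g (d_s Y) s' t' = d_s (shear K g Y) s' t').
  { intros s' t'. symmetry. apply d_s_shear. }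
  (* [Gamma] drops out of the phase of the normal form: the term
     - 2 lambda Gamma in zeta1 compensates the shift of s. *)
  assert (Hphase : forall s' t',
    2 * lambda * s' + (zeta (g t') - 2 * lambda * Gamma (g t'))
    = 2 * lambda * (s' - K t') + zeta (g t')) by (intros; unfold K; ring).
  assert (Had : forall s' t', W s' t' ->
    let q := G (g t') - cos (2 * lambda * (s' - K t') + zeta (g t')) in
    adapted (shear K g Y) s' t' (dg t' * (N (g t') * q))
      (dg t' * (N (g t') * sin (2 * lambda * (s' - K t') + zeta (g t'))))
      (dg t' * (N (g t') / lambda * q))).
  { intros s' t' H q. destruct (HW _ _ H) as (Hth & Ht & HRP).
    destruct (HWder _ _ H) as (DK & Dg & _).
    replace (dg t' * (N (g t') * q)) with (dg t' *
      (1 / (2 * lambda) - N (g t') * cos (2 * lambda * (s' - K t') + zeta (g t')))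
      - dK t').
    - apply (adapted_shear U); auto.
    - unfold q, dK. rewrite <- (HG _ Hth). ring. }
  assert (Hq : forall s' t', W s' t' ->
    0 < eps * (G (g t') - cos (2 * lambda * (s' - K t') + zeta (g t')))).
  { intros s' t' H. destruct (HW _ _ H) as (Hth & Ht & HRP).
    apply HRPiff in HRP; [| now apply HWU]. specialize (HN _ Hth).
    set (q := _ - _) in *.
    replace (eps * q) with (eps * (N (g t') / lambda * q) * (lambda / N (g t')))
      by (field; split; lra).
    apply Rmult_lt_0_compat; [exact HRP |]. apply Rdiv_lt_0_compat; lra. }
  assert (Htau : forall s' t', W s' t' ->
    dg t' * (N (g t') / lambda *
      (G (g t') - cos (2 * lambda * (s' - K t') + zeta (g t')))) <> 0).
  { intros s' t' H. destruct (HW _ _ H) as (Hth & Ht & HRP).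
    specialize (HN _ Hth). specialize (Hq _ _ H). specialize (Hdg0 _ Hth).
    apply Rmult_integral_contrapositive_currified; [exact Hdg0 |].
    apply Rmult_integral_contrapositive_currified.
    - assert (0 < N (g t') / lambda) by (apply Rdiv_lt_0_compat; lra). lra.
    - intros E. rewrite E, Rmult_0_r in Hq. lra. }
  constructor; fold RP; fold W; fold K.
  - apply (immersion_on_shear U W Y K g dK dg); auto.
    intros s' t' H. apply Hdg0, (HW _ _ H).
  - intros s' t' H. exact (transverse_regular _ _ _ _ _ _ (Had _ _ H) (Htau _ _ H)).
  - intros s' t' H. exact (is_e1_adapted _ _ _ _ _ _ _ (Had _ _ H) (HE1 s' t')).
  - intros s' t' H. exact (HE1 s' t').
  - intros s' t' H. exists 1, 0. split.
    + change (shear K g (d_s Y) s' t' =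
        vadd (vscale 1 (d_s (shear K g Y) s' t')) (vscale 0 (d_t (shear K g Y) s' t'))).
      rewrite HE1.
      destruct (d_s (shear K g Y) s' t') as [[? ?] ?],
        (d_t (shear K g Y) s' t') as [[? ?] ?].
      triple. f_equal; [f_equal |]; ring.
    + apply (is_nabla_shear Y (e2 Y (d_s Y)) K g). now apply is_nabla_deformed.
  - intros s' t' e H. destruct (HWopen _ _ H) as [d Hd].
    destruct (sin_nonzero_nearby (2 * lambda)
      (2 * lambda * (s' - K t') + zeta (g t')) (Rmin d e)) as (h & Hh & Hsin).
    { lra. }
    { apply Rmin_pos; apply cond_pos. }
    assert (B1 := Rmin_l d e). assert (B2 := Rmin_r d e).
    assert (Hs : Rabs (s' + h - s') < Rmin d e) by (apply Rabs_def1; lra).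
    assert (Ht : Rabs (t' - t') < Rmin d e).
    { rewrite Rminus_diag, Rabs_R0. lra. }
    assert (HW' : W (s' + h) t') by (apply Hd; lra).
    exists (s' + h), t'. repeat split; try lra; [exact HW' |].
    intros Hal. destruct (HW _ _ HW') as (Hth & _).
    apply (is_alpha_adapted _ _ _ _ _ _ _ _ (Had _ _ HW') (HE1 _ _) (Htau _ _ HW')) in Hal.
    apply Hsin. specialize (HN _ Hth).
    replace (2 * lambda * h + (2 * lambda * (s' - K t') + zeta (g t')))
      with (2 * lambda * (s' + h - K t') + zeta (g t')) by ring.
    set (S := sin (2 * lambda * (s' + h - K t') + zeta (g t'))) in *.
    assert (T := Htau _ _ HW'). set (tau := dg t' * (N (g t') / lambda * _)) in *.
    assert (E : dg t' * (N (g t') * S) = 0).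
    { replace (dg t' * (N (g t') * S)) with (dg t' * (N (g t') * S) / tau * tau)
        by (field; exact T). rewrite <- Hal. ring. }
    apply Rmult_integral in E. destruct E as [E | E].
    + elim (Hdg0 _ Hth E).
    + apply Rmult_integral in E. destruct E; lra.
  - intros s' t' H q al. destruct (HW _ _ H) as (Hth & _).
    specialize (Hq _ _ H). unfold al, q in *. clear al q. fold G. rewrite Hphase.
    set (q := G (g t') - _) in *.
    assert (T := Htau _ _ H). fold q in T.
    assert (A := Had _ _ H). cbv zeta in A. fold q in A.
    specialize (HN _ Hth). specialize (Hdg0 _ Hth).
    assert (Hq0 : q <> 0) by (intros E; rewrite E, Rmult_0_r in Hq; lra).
    set (S := sin _) in *.
    assert (Hal : lambda * (S / q)
      = dg t' * (N (g t') * S) / (dg t' * (N (g t') / lambda * q)))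
      by (field; repeat split; lra).
    split; [exact Hq0 |]. split.
    + exact (proj2 (is_alpha_adapted _ _ _ _ _ _ _ _ A (HE1 s' t') T) Hal).
    + apply (proj2 (is_ab_adapted _ _ _ _ _ _ _ _ _ _ A (HE1 s' t') T Hal)).
      assert (Hr := sqrt_1_sqr_pos (lambda * (S / q))). set (r0 := sqrt _) in *.
      assert (Habs : Rabs q = eps * q).
      { rewrite <- (Rabs_pos_eq (eps * q)) by lra. rewrite Rabs_mult.
        replace (Rabs eps) with 1; [ring |].
        assert (H1 : Rabs eps * Rabs eps = 1)
          by (rewrite <- Rabs_mult, Heps; apply Rabs_R1).
        assert (H2 := Rabs_pos eps). nra. }
      rewrite Habs. unfold dg. split; [field; repeat split; lra |].
      transitivity (2 * lambda ^ 2 * (eps * eps) / (eps * q * r0));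
        [rewrite Heps |]; field; repeat split; lra.
Qed.

Theorem theorem3 (lambda : R) (lambda_pos : 0 < lambda)
    (l r : Rbar) (x1 x2 x3 : R -> R)
    (x1_C1 : C1_curve_on (Interval l r) x1)
    (x2_C1 : C1_curve_on (Interval l r) x2)
    (x3_C1 : C1_curve_on (Interval l r) x3)
    (U : R -> R -> Prop)
    (U_over_I : forall s th, U s th -> Interval l r th)
    (Y_immersion : immersion_on U (deformed lambda x1 x2 x3)) :
  let Y := deformed lambda x1 x2 x3 in
  let e1 := d_s Y in
  let V := funV lambda x1 x2 in
  (forall s th, U s th -> regular Y s th -> V th = (0, 0) ->
     is_alpha Y e1 s th 0) /\
  ((forall th, Interval l r th -> V th <> (0, 0)) ->
   forall zeta int_D int_V : R -> R,
     (forall th, Interval l r th ->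
        (fst (V th) / norm2 (V th), snd (V th) / norm2 (V th))
        = (sin (zeta th), cos (zeta th))) ->
     (forall th, Interval l r th ->
        is_derive int_D th (funD lambda x1 x2 x3 th)) ->
     (forall th, Interval l r th -> is_derive int_V th (norm2 (V th))) ->
     let Gamma th := th / (2 * lambda) - int_D th in
     let Psi th := 2 * lambda * int_V th in
     let zeta1 th := zeta th - 2 * lambda * Gamma th in
     let zeta2 := funG lambda x1 x2 x3 in
     (forall s th, U s th -> regular Y s th ->
        regular_part 1 U Y e1 s th \/ regular_part (-1) U Y e1 s th) /\
     normal_change lambda (Interval l r) (regular_part 1 U Y e1) Y e1
       Gamma Psi zeta1 zeta2 /\
     normal_change lambda (Interval l r) (regular_part (-1) U Y e1) Y e1
       Gamma (fun th => - Psi th) zeta1 zeta2).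
Proof.
  intros Y e1 V. split.
  - intros s th Hst Hreg HV. assert (Hth := U_over_I _ _ Hst).
    assert (Had := adapted_deformed lambda x1 x2 x3 s th (Rgt_not_eq _ _ lambda_pos)
      (proj1 (x1_C1 _ Hth)) (proj1 (x2_C1 _ Hth)) (proj1 (x3_C1 _ Hth))).
    cbv zeta in Had.
    assert (Htau := regular_transverse _ _ _ _ _ _ Had
      (proj2 (proj2 (proj2 (proj2 Y_immersion))) _ _ Hst) Hreg).
    apply (is_alpha_adapted Y e1 _ _ _ _ _ _ Had eq_refl Htau).
    unfold V, funV in HV. injection HV. intros HB HA. rewrite HA, HB.
    rewrite !Rmult_0_r, Rplus_0_r. unfold Rdiv. now rewrite Rmult_0_l.
  - intros HV zeta int_D int_V Hzeta HD HintV Gamma Psi zeta1 zeta2.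
    split; [| split].
    + intros s th Hst Hreg. assert (Hth := U_over_I _ _ Hst).
      assert (Had := adapted_deformed lambda x1 x2 x3 s th (Rgt_not_eq _ _ lambda_pos)
        (proj1 (x1_C1 _ Hth)) (proj1 (x2_C1 _ Hth)) (proj1 (x3_C1 _ Hth))).
      cbv zeta in Had.
      assert (Htau := regular_transverse _ _ _ _ _ _ Had
        (proj2 (proj2 (proj2 (proj2 Y_immersion))) _ _ Hst) Hreg).
      set (tau := _ / lambda) in Had, Htau.
      destruct (Rdichotomy _ _ Htau) as [H | H]; [right | left];
        apply (regular_part_adapted _ _ _ _ _ _ _ _ _ Y_immersion Hst Had eq_refl);
        lra.
    + apply (normal_change_deformed lambda 1); auto; [ring |].
      intros th Hth. rewrite Rmult_1_l. apply is_derive_scal, HintV, Hth.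
    + apply (normal_change_deformed lambda (-1)); auto; [ring |].
      intros th Hth. replace (-1 * (2 * lambda * norm2 (funV lambda x1 x2 th)))
        with (- (2 * lambda * norm2 (V th))) by (unfold V; ring).
      apply (is_derive_opp (V := R_NormedModule)). apply is_derive_scal, HintV, Hth.
Qed.
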